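(* Let $\mathcal{T}\le\mathrm{AGL}(V,+)$ be an elementary abelian regular subgroup and let $d=\dim(W(\mathcal{T}))$. If $\mathcal{T}\neq T$, then $$\frac{(-1)^n+3}{2}\le d\le n-2.$$
   Context: $n\ge 2$ and $V=(\mathbb{F}_2)^n$. $T=\{\sigma_a\mid a\in V\}$, where $\sigma_a:x\mapsto x+a$, is the translation group, and $\mathrm{AGL}(V)=\mathrm{AGL}(V,+)=\mathrm{GL}(V)\ltimes T$. For an elementary abelian regular subgroup $\mathcal{T}\le \mathrm{AGL}(V)$ (regular in its action on $V$), $W(\mathcal{T})=\{a\in V\mid\sigma_a\in\mathcal{T}\}$, which is a subspace of $V$. *)

(* Defs.v *)
From HB Require Import structures.
From mathcomp Require Import all_boot all_order all_fingroup all_algebra all_solvable.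

Set Implicit Arguments.
Unset Strict Implicit.
Unset Printing Implicit Defensive.

Import GroupScope GRing.Theory.
Local Open Scope ring_scope.

Section AffineGroup.

Variable n : nat.
Local Notation V := 'rV['F_2]_n.

Definition transl (a : V) : {perm V} := perm (addIr a).

Lemma translE (a x : V) : transl a x = x + a.
Proof. by rewrite permE. Qed.

Lemma translD (a b : V) : transl (a + b) = (transl a * transl b)%g.
Proof. by apply/permP=> x; rewrite permM !translE addrA. Qed.

Lemma transl0 : transl 0 = 1%g.
Proof. by apply/permP=> x; rewrite translE addr0 perm1. Qed.

Lemma translN (a : V) : transl (- a) = (transl a)^-1%g.
Proof.
by apply/eqP; rewrite eq_sym eq_invg_mul -translD subrr transl0.
Qed.

Definition translations : {set {perm V}} := [set transl a | a : V].

Lemma translations_group_set : group_set translations.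
Proof.
apply/group_setP; split; first by apply/imsetP; exists 0; rewrite ?transl0.
by move=> _ _ /imsetP[a _ ->] /imsetP[b _ ->]; rewrite -translD imset_f.
Qed.
Canonical translations_group := Group translations_group_set.

(* GL(V), as the group of the linear bijections of V. *)
Definition GLperm : {set {perm V}} :=
  [set s : {perm V} | [forall k : 'F_2, forall x : V, forall y : V,
                        s (k *: x + y) == k *: s x + s y]].

Lemma GLpermP (s : {perm V}) : reflect (linear s) (s \in GLperm).
Proof.
rewrite inE; apply: (iffP idP) => [+ k x y | lin_s].
  by move=> /forallP/(_ k)/forallP/(_ x)/forallP/(_ y)/eqP.
by apply/forallP=> k; apply/forallP=> x; apply/forallP=> y; apply/eqP; exact: lin_s.
Qed.

Lemma GLperm_group_set : group_set GLperm.
Proof.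
apply/group_setP; split; first by apply/GLpermP=> k x y; rewrite !perm1.
move=> s t /GLpermP lin_s /GLpermP lin_t; apply/GLpermP=> k x y.
by rewrite !permM lin_s lin_t.
Qed.
Canonical GLperm_group := Group GLperm_group_set.

(* Products of permutations are composed from left to right, so the elements  *)
(* of AGLperm are the maps x |-> s x + a with s linear.                        *)
Definition AGLperm : {set {perm V}} := (GLperm * translations)%g.

Lemma GLpermD (s : {perm V}) :
  s \in GLperm -> forall x y, s (x + y) = s x + s y.
Proof. by move=> /GLpermP lin_s x y; rewrite -[x in LHS]scale1r lin_s scale1r. Qed.

Lemma GLperm_norm : GLperm \subset 'N(translations).
Proof.
apply/subsetP=> s Gs; rewrite inE; apply/subsetP=> _ /imsetP[_ /imsetP[a _ ->] ->].
apply/imsetP; exists (s a) => //; apply/permP=> x.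
by rewrite conjgE !permM !translE (GLpermD Gs) permKV.
Qed.

Lemma AGLperm_group_set : group_set AGLperm.
Proof.
by rewrite /AGLperm (normC GLperm_norm) -norm_joinEr ?groupP ?GLperm_norm.
Qed.
Canonical AGLperm_group := Group AGLperm_group_set.

Lemma AGLperm_sdprod : translations ><| GLperm = AGLperm.
Proof.
rewrite sdprodE ?GLperm_norm //; first by rewrite /AGLperm (normC GLperm_norm).
apply/trivgP/subsetP=> _ /setIP[/imsetP[a _ ->] /GLpermD/(_ 0 0)].
rewrite !translE !add0r => /eqP; rewrite -subr_eq subrr eq_sym => /eqP->.
by rewrite transl0 inE.
Qed.

Definition regular_perm (G : {set {perm V}}) :=
  [transitive G, on [set: V] | 'P] && [forall x : V, 'C_G[x | 'P] == 1%g].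

(* W(G) is the set of the a such that transl a \in G; for a group G this set  *)
(* is already a subspace (see mem_Wspace), so taking the span adds nothing.   *)
Definition Wspace (G : {set {perm V}}) : {vspace V} :=
  <<enum [set a : V | transl a \in G]>>%VS.

Lemma mem_Wspace (G : {group {perm V}}) (a : V) :
  (a \in Wspace G) = (transl a \in G).
Proof.
apply/idP/idP=> [|Ga]; last by apply: memv_span; rewrite mem_enum inE.
rewrite /Wspace -(in_tupleE (enum _)) => /coord_span ->.
elim/big_ind: _ => [|x y Gx Gy|i _]; first by rewrite transl0 group1.
  by rewrite translD groupM.
set u := _`_i; have: u \in enum [set b : V | transl b \in G] by apply: mem_nth.
rewrite mem_enum inE; case: (coord _ _ _) => [[|[|//]] lt_m] Gu.
  by rewrite (_ : Ordinal _ = 0) ?scale0r ?transl0 ?group1 //; apply: val_inj.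
by rewrite (_ : Ordinal _ = 1) ?scale1r //; apply: val_inj.
Qed.

End AffineGroup.

(* Main.v *)
Require Import Defs.
From HB Require Import structures.
From mathcomp Require Import all_boot all_order all_fingroup all_algebra all_solvable.
From mathcomp Require Import zify ring.

Set Implicit Arguments.
Unset Strict Implicit.
Unset Printing Implicit Defensive.

Import GRing.Theory Num.Theory.
Local Open Scope ring_scope.

(** The proof turns the group into an algebra.  As G is regular, every a in V
    is the image of 0 under a single element g_a of G, and x o y = g_y x is a
    group law on V isomorphic to G.  Its deviation from addition,
    x ** y = g_y x - x - y, is additive in x because g_y is affine, and
    commutative because G is; with that, associativity of o becomes
    associativity of **, and exponent 2 becomes x ** x = 0.  So (V, +, ** ) is
    an associative commutative algebra over F_2 with all squares zero, and its
    annihilator is exactly W(G), the only elements of G that are translations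
    being the g_a with a ** V = 0.

    Upper bound.  If G is not the translation group, some x is outside W, hence
    x ** y <> 0 for some y.  As squares vanish, x and y are linearly
    independent modulo W, so W has codimension at least 2
    (annihilator_codim).

    Lower bound.  Every x outside W has a nonzero multiple x ** y in W
    (exists_multiple_in_annihilator); in particular W <> 0.  It remains to see
    that dim W = 1 forces n to be odd (odd_dim_of_annihilator_line).  Take a
    linear functional f that is nonzero on the line W.  The bilinear form
    f (x ** y) is alternating, and its radical is W, since the multiples of an
    x outside W meet W \ 0, where f does not vanish.  An alternating form has
    even rank (odd_rank_alternating), so n - 1 is even. *)

(** * Alternating matrices have even rank *)

(** An isotropic row space U that is not equal to its orthogonal grows: adding
    to U any vector orthogonal to it keeps it isotropic, that vector being
    orthogonal to itself.  The orthogonal of U is kermx (B *m U^T). *)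
Lemma exists_lagrangian (F : fieldType) (n : nat) (B : 'M[F]_n)
    (altB : forall x : 'rV_n, x *m B *m x^T = 0) (skewB : B^T = - B) :
  exists m, exists2 U : 'M[F]_(m, n),
    U *m B *m U^T = 0 & (kermx (B *m U^T) <= U)%MS.
Proof.
suff max_iso k m (U : 'M[F]_(m, n)) :
    (n - \rank U <= k)%N -> U *m B *m U^T = 0 ->
    exists m, exists2 U : 'M[F]_(m, n),
      U *m B *m U^T = 0 & (kermx (B *m U^T) <= U)%MS.
  by apply: (max_iso n 0%N 0); rewrite ?leq_subr // !mul0mx.
elim: k m U => [|k IHk] m U rkU isoU.
  exists m, U => //; apply: submx_full.
  by rewrite /row_full eqn_leq rank_leq_col -subn_eq0 -leqn0.
have [kerU|] := boolP (kermx (B *m U^T) <= U)%MS; first by exists m, U.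
case/row_subPn => i; set x := row i _ => nUx.
have xBU : x *m B *m U^T = 0.
  by apply/eqP; rewrite -mulmxA -sub_kermx row_sub.
have UBx : U *m B *m x^T = 0.
  apply: trmx_inj; rewrite !trmx_mul trmxK skewB mulNmx mulmxN trmx0.
  by rewrite mulmxA xBU oppr0.
apply: (IHk _ (col_mx U x)).
  have ltU: (\rank U < \rank (col_mx U x))%N.
    rewrite -addsmxE ltn_neqAle mxrankS ?addsmxSl // andbT.
    rewrite (mxrank_leqif_sup (addsmxSl _ _)) addsmx_sub submx_refl /=.
    exact: nUx.
  by rewrite -ltnS (leq_trans _ rkU) // ltn_sub2l // (leq_trans ltU) ?rank_leq_col.
rewrite mul_col_mx tr_col_mx mul_col_mx !mul_mx_row isoU UBx xBU altB.
by rewrite !row_mx0 col_mx0.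
Qed.

(** A maximal isotropic U contains the radical of B and equals its orthogonal,
    so rank U = n - rank (U *m B), while rank U = rank (U *m B) + (n - rank B)
    because the radical is the kernel of B on U.  Hence
    rank B = 2 rank (U *m B). *)
Lemma odd_rank_alternating (F : fieldType) (n : nat) (B : 'M[F]_n)
    (altB : forall x : 'rV_n, x *m B *m x^T = 0) :
  odd (\rank B) = false.
Proof.
have skewB : B^T = - B.
  apply/matrixP=> i j; have := altB (delta_mx 0 i + delta_mx 0 j).
  rewrite linearD /= !mulmxDl !mulmxDr !altB add0r addr0 => /matrixP/(_ 0 0).
  rewrite -!rowE !trmx_delta -!colE !mxE => /eqP.
  by rewrite addrC addr_eq0 => /eqP.
have [m [U isoU perpU]] := exists_lagrangian altB skewB.
have kerU : (kermx B <= U)%MS.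
  by apply: submx_trans perpU; rewrite sub_kermx mulmxA mulmx_ker mul0mx.
have eqU : \rank U = (n - \rank (B *m U^T))%N.
  rewrite -mxrank_ker; apply/eqP; rewrite eqn_leq !mxrankS //.
  by rewrite sub_kermx mulmxA isoU.
have rkBU : \rank (B *m U^T) = \rank (U *m B).
  by rewrite -mxrank_tr trmx_mul trmxK skewB mulmxN mxrank_opp.
have := mxrank_mul_ker U B; rewrite (capmx_idPr kerU) mxrank_ker eqU rkBU.
have := rank_leq_row B; have := rank_leq_col (U *m B).
move: (\rank _) (\rank B) => r s le_rn le_sn dimU.
have -> : s = (r + r)%N by lia.
by rewrite oddD addbb.
Qed.

(** * Commutative associative algebras over F_2 with zero squares *)

Section AlternatingAlgebra.

Variable n : nat.
Local Notation V := 'rV['F_2]_n.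
Variables (mul : V -> V -> V) (W : {vspace V}).
Local Notation "x ** y" := (mul x y) (at level 40, left associativity).
Hypothesis mulDl : forall x y z, (x + y) ** z = x ** z + y ** z.
Hypothesis mulC : forall x y, x ** y = y ** x.
Hypothesis mulA : forall x y z, x ** (y ** z) = x ** y ** z.
Hypothesis mulxx : forall x, x ** x = 0.
Hypothesis WP : forall x, reflect (forall y, x ** y = 0) (x \in W).

Let mulDr x y z : x ** (y + z) = x ** y + x ** z.
Proof. by rewrite mulC mulDl !(mulC x). Qed.

Let mul0v x : 0 ** x = 0.
Proof. by apply: (addrI (0 ** x)); rewrite -mulDl !addr0. Qed.

Let mulv0 x : x ** 0 = 0.
Proof. by rewrite mulC. Qed.

Let notinW x : x \notin W -> exists y, x ** y != 0.
Proof.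
move=> nWx; apply/existsP; apply: contraNT nWx; rewrite negb_exists.
by move/forallP=> x0; apply/WP=> y; apply/eqP; rewrite -[_ == _]negbK.
Qed.

(** Among the nonzero multiples x ** y choose one with the largest annihilator.
    If some z had x ** y ** z <> 0, this further multiple of x would be killed
    by everything that kills x ** y and also by z, as z ** z = 0. *)
Lemma exists_multiple_in_annihilator x :
  x \notin W -> exists2 y, x ** y != 0 & x ** y \in W.
Proof.
case/notinW=> y0 xy0.
case: (@arg_maxnP _ y0 (fun y => x ** y != 0)
         (fun y => #|[set z | x ** y ** z == 0]|) xy0) => y xy maxy.
exists y => //; apply: contraT => /notinW[z xyz].
have := maxy (y ** z); rewrite mulA => /(_ xyz) /=; rewrite leqNgt => /negP[].
apply: proper_card; apply/properP; split.
  apply/subsetP=> t; rewrite !inE => /eqP xyt.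
  by rewrite -mulA (mulC z) mulA xyt mul0v.
by exists z; rewrite !inE // -mulA mulxx mulv0.
Qed.

Lemma annihilator_gt0 : (0 < n)%N -> (0 < \dim W)%N.
Proof.
move=> n_gt0; rewrite lt0n dimv_eq0; apply/eqP=> W0.
have [x x_neq0] : exists x : V, x != 0.
  exists (const_mx 1); apply/eqP => /rowP/(_ (Ordinal n_gt0)).
  by rewrite !mxE => /eqP; rewrite oner_eq0.
have [|y xy] := @exists_multiple_in_annihilator x; first by rewrite W0 memv0.
by rewrite W0 memv0 (negPf xy).
Qed.

(** Any y with x ** y <> 0 stays outside W + <[x]>, on which multiplication
    by x vanishes because x ** x = 0; so adjoining x and then y to W raises
    the dimension twice. *)
Lemma annihilator_codim x : x \notin W -> (\dim W + 2 <= n)%N.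
Proof.
move=> nWx; have [y xy] := notinW nWx.
have dim_lt (U : {vspace V}) v : v \notin U -> (\dim U < \dim (U + <[v]>))%N.
  move=> nUv; rewrite ltn_neqAle dimvS ?addvSl // andbT.
  by rewrite (dimv_leqif_sup (addvSl _ _)) subv_add subvv -memvE.
have nWxy : y \notin (W + <[x]>)%VS.
  apply: contraNN xy => /memv_addP[w /WP Ww [_ /vlineP[k ->] ->]].
  rewrite mulDr mulC Ww add0r.
  case: k => [[|[|//]] lt_k]; last first.
    by rewrite (_ : Ordinal _ = 1) ?scale1r ?mulxx //; apply: val_inj.
  by rewrite (_ : Ordinal _ = 0) ?scale0r ?mulv0 //; apply: val_inj.
have := leq_ltn_trans (dim_lt _ _ nWx) (dim_lt _ _ nWxy).
move/leq_trans/(_ (dimvS (subvf _))).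
by rewrite dimvf /dim /= mul1n addn2.
Qed.

(** The i-th coordinate, for an i where w does not vanish, serves as linear
    functional: (x, y) |-> (x ** y) 0 i is an alternating form with radical
    W = <[w]>. *)
Lemma odd_dim_of_annihilator_line : \dim W = 1%N -> odd n.
Proof.
move=> dimW; pose w := vpick W.
have w_neq0 : w != 0 by rewrite vpick0 -dimv_eq0 dimW.
have Ww : w \in W by apply: memv_pick.
have defW : W = <[w]>%VS.
  by apply/esym/eqP; rewrite eqEdim -memvE Ww dim_vline w_neq0 dimW.
have [i wi] : exists i, w 0 i != 0 by apply/rV0Pn.
pose B := \matrix_(j, k) (delta_mx 0 j ** delta_mx 0 k : V) 0 i.
have BE (x y : V) : (x *m B *m y^T) 0 0 = (x ** y) 0 i.
  (* Additivity is linearity here, as 0 and 1 are the only scalars. *)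
  have scale_mul (a : 'F_2) u v : (a *: u) ** v = a *: (u ** v).
    case: a => [[|[|//]] lt_a].
      by rewrite (_ : Ordinal _ = 0) ?scale0r ?mul0v //; apply: val_inj.
    by rewrite (_ : Ordinal _ = 1) ?scale1r //; apply: val_inj.
  have sum_mul (f : 'I_n -> V) v :
      (\sum_j f j) ** v = \sum_j f j ** v.
    exact: (big_morph (mul^~ v) (fun a b => mulDl a b v) (mul0v v)).
  rewrite [in RHS](row_sum_delta x) sum_mul summxE.
  rewrite -mulmxA mxE; apply: eq_bigr => j _; rewrite scale_mul [RHS]mxE.
  congr (_ * _).
  rewrite [in RHS](row_sum_delta y) mulC sum_mul summxE mxE.
  by apply: eq_bigr => k _; rewrite scale_mul !mxE mulC mulrC.
have altB (x : V) : x *m B *m x^T = 0.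
  by apply/matrixP=> j k; rewrite !ord1 BE mulxx !mxE.
have kerB : (kermx B :=: w)%MS.
  apply/eqmxP/andP; split.
    apply/rV_subP=> x; rewrite sub_kermx => /eqP xB.
    have xW : x \in W.
      apply: contraT => /exists_multiple_in_annihilator[y xy].
      rewrite defW => /vlineP[k xyE]; case/negP: xy.
      have := BE x y; rewrite xB mul0mx xyE !mxE => /esym/eqP.
      by rewrite mulf_eq0 (negPf wi) orbF => /eqP->; rewrite scale0r.
    by move: xW; rewrite defW => /vlineP[k ->]; rewrite scalemx_sub.
  rewrite sub_kermx; apply/eqP/rowP=> j.
  by have := BE w (delta_mx 0 j); rewrite (WP w Ww) trmx_delta -colE !mxE.
have rkB : (n - \rank B)%N = 1%N by rewrite -mxrank_ker kerB rank_rV w_neq0.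
have -> : odd n = ~~ odd (\rank B) by lia.
by rewrite (odd_rank_alternating altB).
Qed.

End AlternatingAlgebra.

(** * The algebra of a regular elementary abelian affine group *)

Section RegularSubgroup.

Variable n : nat.
Local Notation V := 'rV['F_2]_n.
Variable G : {group {perm V}}.
Hypothesis n_gt0 : (0 < n)%N.
Hypothesis sG_AGL : G \subset AGLperm n.
Hypothesis abelG : is_abelem G.
Hypothesis regG : regular_perm G.

Lemma addvv (x : V) : x + x = 0.
Proof. by apply/rowP=> i; rewrite !mxE addrr_pchar2 // pchar_Fp. Qed.

(** The element g_a of G that sends 0 to a; the default value never occurs, G
    being transitive. *)
Definition regular_elt (a : V) : {perm V} :=
  odflt 1%g [pick g in G | g 0 == a].

Lemma regular_eltP a : regular_elt a \in G /\ regular_elt a 0 = a.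
Proof.
rewrite /regular_elt; case: pickP => [g /andP[Gg /eqP //]|noG].
have [/atransP/(_ 0 (in_setT _)) orbG _] := andP regG.
have /orbitP[g Gg /eqP ga] : a \in orbit 'P G (0 : V) by rewrite orbG inE.
by have := noG g; rewrite Gg /= -[g 0]/('P%act 0 g) ga.
Qed.

Lemma regular_inj g h : g \in G -> h \in G -> g 0 = h 0 -> g = h.
Proof.
move=> Gg Gh gh0; have [_ /forallP/(_ 0)/eqP freeG] := andP regG.
have : (g * h^-1)%g \in 'C_G[0 : V | 'P]%g.
  rewrite inE groupM ?groupV //=; apply/astab1P.
  by rewrite /= /aperm permM gh0 permK.
by rewrite freeG => /set1gP/eqP; rewrite -eq_mulgV1 => /eqP.
Qed.

Lemma regular_elt_eq g a : g \in G -> g 0 = a -> regular_elt a = g.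
Proof.
by move=> Gg g0; have [Ga a0] := regular_eltP a; apply: regular_inj; rewrite ?a0.
Qed.

(** The order of G, counted by g |-> g 0; it identifies the prime implicit in
    is_abelem as 2. *)
Lemma card_regular : #|G| = (2 ^ n)%N.
Proof.
have inj_vec : injective regular_elt.
  by move=> a b /(congr1 (fun g : {perm V} => g 0)); rewrite !(regular_eltP _).2.
have -> : (2 ^ n)%N = #|[set: V]|.
  by rewrite cardsT card_mx card_Fp ?mul1n.
rewrite -(card_imset _ inj_vec); apply: eq_card => g; apply/idP/imsetP.
  by move=> Gg; exists (g 0); rewrite ?inE // (regular_elt_eq Gg).
by case=> a _ ->; case: (regular_eltP a).
Qed.

Lemma regular_abelem2 : (2.-abelem G)%g.
Proof.
have pdiv2 : pdiv (2 ^ n) = 2 by rewrite -(prednK n_gt0) pdiv_pfactor.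
by have := abelG; rewrite /is_abelem card_regular pdiv2.
Qed.

Lemma affineD g x y : g \in G -> g (x + y) = g x + g y - g 0.
Proof.
move/(subsetP sG_AGL)/mulsgP=> [s _ Ls /imsetP[a _ ->] ->].
have s0 : s 0 = 0 by apply: (addrI (s 0)); rewrite -(GLpermD Ls) !addr0.
by rewrite !permM !translE (GLpermD Ls) s0 add0r addrA addrK addrAC.
Qed.

(** The deviation of the group law x o y = g_y x from addition. *)
Definition prod_vec (a b : V) : V := regular_elt b a - a - b.
Local Notation "a ** b" := (prod_vec a b) (at level 40, left associativity).

Lemma regular_eltE a b : regular_elt b a = a + b + a ** b.
Proof. by rewrite /prod_vec -[_ - a - b]addrA -opprD [RHS]addrC subrK. Qed.

(** Associativity of the law x o y = g_y x: the product g_b * g_c sends 0 to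
    g_c b, so it is the element of G attached to that vector. *)
Lemma regular_eltM a b c :
  regular_elt c (regular_elt b a) = regular_elt (regular_elt c b) a.
Proof.
have [[Gb b0] [Gc _]] := (regular_eltP b, regular_eltP c).
by rewrite -permM -(@regular_elt_eq _ (regular_elt c b) (groupM Gb Gc)) // permM b0.
Qed.

Lemma regular_eltC a b : regular_elt b a = regular_elt a b.
Proof.
have [[Ga a0] [Gb b0]] := (regular_eltP a, regular_eltP b).
rewrite -{1}a0 -[in RHS]b0 -!permM; congr (fun_of_perm _ 0).
exact: (centsP (abelem_abelian regular_abelem2)).
Qed.

Lemma prod_vecDl x y z : (x + y) ** z = x ** z + y ** z.
Proof.
have [Gz z0] := regular_eltP z.
rewrite /prod_vec affineD // z0.
by apply/rowP=> i; rewrite !mxE; ring.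
Qed.

Lemma prod_vecC x y : x ** y = y ** x.
Proof. by rewrite /prod_vec regular_eltC addrAC. Qed.

(** Both sides of (x o y) o z = x o (y o z), with x o y = x + y + x ** y,
    contain the sum of x, y, z and their pairwise products; what remains is
    x ** y ** z on one side and x ** (y ** z) on the other. *)
Lemma prod_vecA x y z : x ** (y ** z) = x ** y ** z.
Proof.
have := regular_eltM x y z.
rewrite [regular_elt z y]regular_eltE [regular_elt y x]regular_eltE.
rewrite [LHS]regular_eltE [RHS]regular_eltE.
rewrite (prod_vecDl (x + y)) (prod_vecDl x) (prod_vecC x (_ + _)).
rewrite (prod_vecDl (y + z)) (prod_vecDl y) !(prod_vecC _ x).
move: (x ** y) (x ** z) (y ** z) => p q r; move: (p ** z) (x ** r) => s t eq_st.
apply: (addrI (x + y + z + p + q + r)).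
transitivity (x + (y + z + r) + (p + q + t)).
  by apply/rowP=> i; rewrite !mxE; ring.
by rewrite -eq_st; apply/rowP=> i; rewrite !mxE; ring.
Qed.

Lemma prod_vecxx x : x ** x = 0.
Proof.
have [Gx x0] := regular_eltP x.
have [_ /(_ _ Gx) x2] := abelemP (isT : prime 2) regular_abelem2.
have xx : (regular_elt x * regular_elt x)%g = 1%g := x2.
by rewrite /prod_vec -{2}x0 -permM xx perm1 sub0r -opprD addvv oppr0.
Qed.

Lemma mem_Wspace_prod x : reflect (forall y, x ** y = 0) (x \in Wspace G).
Proof.
rewrite mem_Wspace; apply: (iffP idP) => [Gx y | x_ann].
  have tx : regular_elt x = transl x by apply: regular_elt_eq; rewrite // translE add0r.
  by rewrite prod_vecC /prod_vec tx translE addrAC addrK subrr.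
have [Gx _] := regular_eltP x; suff -> : transl x = regular_elt x by [].
by apply/permP=> y; rewrite translE regular_eltE prod_vecC x_ann addr0.
Qed.

Lemma eq_translations : (forall x, x \in Wspace G) ->
  G = translations n :> {set {perm V}}.
Proof.
move=> allW; apply/setP=> g; apply/idP/imsetP => [Gg | [a _ ->]].
  exists (g 0) => //; apply: regular_inj; rewrite -?mem_Wspace //.
  by rewrite translE add0r.
by rewrite -mem_Wspace.
Qed.

End RegularSubgroup.

Theorem proposition4p1 (n : nat) (n_ge2 : (2 <= n)%N)
    (G : {group {perm 'rV['F_2]_n}})
    (sG_AGL : G \subset AGLperm n)
    (abelG : is_abelem G)
    (regG : regular_perm G)
    (neqGT : G <> translations n :> {set {perm 'rV['F_2]_n}}) :
  ((-1) ^+ n + 3) / 2 <= (\dim (Wspace G))%:R :> rat /\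
  (\dim (Wspace G))%:R <= n%:R - 2 :> rat.
Proof.
have n_gt0 : (0 < n)%N by apply: ltnW.
have mDl := prod_vecDl sG_AGL regG.
have mC := prod_vecC n_gt0 abelG regG.
have mA := prod_vecA n_gt0 sG_AGL abelG regG.
have mxx := prod_vecxx n_gt0 abelG regG.
have mW := mem_Wspace_prod n_gt0 abelG regG.
split; last first.
  have [allW|/forallPn[x nWx]] := boolP [forall x, x \in Wspace G].
    by case: neqGT; apply: (eq_translations regG); apply/forallP.
  have := annihilator_codim mDl mC mxx mW nWx.
  by rewrite lerBrDr -natrD ler_nat.
have := annihilator_gt0 mDl mC mA mxx mW n_gt0.
rewrite -signr_odd; case: (boolP (odd n)) => [_|even_n] d_gt0.
  have -> : ((-1) ^+ true + 3) / 2 = 1 :> rat by [].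
  by rewrite ler1n.
have -> : ((-1) ^+ false + 3) / 2 = 2 :> rat by [].
rewrite ler_nat ltn_neqAle d_gt0 andbT eq_sym.
by apply: contraNneq even_n; apply: odd_dim_of_annihilator_line mDl mC mA mxx mW.
Qed.
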